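(* Let $(A,\alpha_A)$ and $(B,\alpha_B)$ be two regular Hom-groups. Then $A\otimes B\cong A^{ab}\otimes B^{ab}$. In particular, $A\otimes B$ is a regular abelian Hom-group.
   Context: A Hom-group $(G,\mu,e,\alpha)$ is a set $G$ with an element $e$, a binary operation $\mu$ (written as a product) and a map $\alpha:G\to G$ such that for all $g,h,k\in G$: (1) $\alpha(g)(hk)=(gh)\alpha(k)$; (2) $\alpha(gh)=\alpha(g)\alpha(h)$; (3) $ge=eg=\alpha(g)$ and $\alpha(e)=e$; (4) there is a map $g\mapsto g^{-1}$ with $(gh)^{-1}=h^{-1}g^{-1}$; (5) for every $g$ there is a natural number $k$ with $\alpha^k(gg^{-1})=\alpha^k(g^{-1}g)=e$. It is regular if $\alpha$ is invertible, in which case (5) becomes $gg^{-1}=g^{-1}g=e$; it is abelian if the product is commutative. A homomorphism of Hom-groups is a map preserving products and commuting with the twist maps; an isomorphism is a bijective homomorphism. For a regular Hom-group $G$, the commutator Hom-subgroup $N=[G,G]$ is the Hom-subgroup generated by the elements $(g^{-1}h^{-1})(gh)$, and $G^{ab}=G/N$ is the quotient Hom-group of cosets $gN$ with $(gN)(hN)=(gh)N$ and twist map $gN\mapsto\alpha(g)N$. For Hom-groups $(A,\alpha_A)$, $(B,\alpha_B)$, $(C,\alpha_C)$ ($C$ written additively even if not commutative), a map $f:A\times B\to C$ is Hom-bilinear if for all $a,a_1,a_2\in A$, $b,b_1,b_2\in B$: $f(a_1a_2,\alpha_B(b))=f(a_1,b)+f(a_2,b)$; $f(\alpha_A(a),b_1b_2)=f(a,b_1)+f(a,b_2)$;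 $f(\alpha_A(a),\alpha_B(b))=\alpha_C(f(a,b))$. A tensor product of regular Hom-groups $A$ and $B$ is a regular Hom-group $(A\otimes B,\alpha_{A\otimes B})$ with a Hom-bilinear map $\theta:A\times B\to A\otimes B$ such that for every regular Hom-group $(C,\alpha_C)$ and every Hom-bilinear map $f:A\times B\to C$ there is a unique Hom-group homomorphism $\widetilde f:A\otimes B\to C$ with $\widetilde f\circ\theta=f$. *)

(* Defs.v *)
From HB Require Import structures.
From mathcomp Require Import all_boot.
From mathcomp Require Import boolp classical_sets.

Set Implicit Arguments.
Unset Strict Implicit.
Unset Printing Implicit Defensive.

Local Open Scope classical_set_scope.

(* The inverse map is part of the structure because the commutators
   (g^-1 h^-1)(gh) refer to it. When [twist] is bijective it is determined by
   the other operations (lemma [hinv_uniq]). *)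
HB.mixin Record isHomGroup (G : Type) := {
  hmul : G -> G -> G;
  hone : G;
  twist : G -> G;
  hinv : G -> G;
  hmulA : forall g h k, hmul (twist g) (hmul h k) = hmul (hmul g h) (twist k);
  twistM : forall g h, twist (hmul g h) = hmul (twist g) (twist h);
  hmulg1 : forall g, hmul g hone = twist g;
  hmul1g : forall g, hmul hone g = twist g;
  twist1 : twist hone = hone;
  hinvM : forall g h, hinv (hmul g h) = hmul (hinv h) (hinv g);
  hmulgV_iter : forall g, exists k : nat,
    iter k twist (hmul g (hinv g)) = hone /\
    iter k twist (hmul (hinv g) g) = hone
}.

#[short(type="homGroupType")]
HB.structure Definition HomGroup := {G of isHomGroup G}.

Declare Scope homgroup_scope.
Delimit Scope homgroup_scope with hg.
Notation "g * h" := (hmul g h) : homgroup_scope.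
Notation "g ^-1" := (hinv g) : homgroup_scope.
Local Open Scope homgroup_scope.

Definition regular (G : homGroupType) : Prop := bijective (@twist G).

Definition abelian (G : homGroupType) : Prop := forall g h : G, g * h = h * g.

HB.mixin Record HomGroup_isRegular G of HomGroup G := {
  twist_bij : regular G
}.

#[short(type="regHomGroupType")]
HB.structure Definition RegHomGroup := {G of HomGroup G & HomGroup_isRegular G}.

Definition is_hom (G H : homGroupType) (f : G -> H) : Prop :=
  (forall g h, f (g * h) = f g * f h) /\ (forall g, f (twist g) = twist (f g)).

Definition isomorphic (G H : homGroupType) : Prop :=
  exists f : G -> H, is_hom f /\ bijective f.

Definition hom_subgroup (G : homGroupType) (H : set G) : Prop :=
  [/\ H hone,
      forall g h, H g -> H h -> H (g * h),
      forall g, H g -> H (g^-1) &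
      forall g, H g -> H (twist g)].

Definition commutator (G : homGroupType) : set G :=
  smallest (@hom_subgroup G)
    [set x | exists g h : G, x = (g^-1 * h^-1) * (g * h)].

Definition coset (G : homGroupType) (N : set G) (g : G) : set G :=
  [set g * n | n in N].

Definition abelianization (G : homGroupType) : Type :=
  {X : set G | exists g, X = coset (@commutator G) g}.

Definition hom_bilinear (A B C : homGroupType) (f : A * B -> C) : Prop :=
  [/\ forall a1 a2 b, f ((a1 * a2)%hg, twist b) = f (a1, b) * f (a2, b),
      forall a b1 b2, f (twist a, (b1 * b2)%hg) = f (a, b1) * f (a, b2) &
      forall a b, f (twist a, twist b) = twist (f (a, b))].

Definition is_tensor_product (A B T : regHomGroupType) (theta : A * B -> T)
    : Prop :=
  hom_bilinear theta /\
  forall (C : regHomGroupType) (f : A * B -> C), hom_bilinear f ->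
    exists! ft : T -> C, is_hom ft /\ ft \o theta = f.

Section RegularTheory.
Variable G : regHomGroupType.
Implicit Types g h : G.

Lemma twist_inj : injective (@twist G).
Proof. exact: bij_inj twist_bij. Qed.

Lemma iter_twist1 (H : homGroupType) k : iter k twist (hone : H) = hone.
Proof. by elim: k => //= k ->; rewrite twist1. Qed.

Lemma hmulgV g : g * g^-1 = hone.
Proof.
have [k [+ _]] := hmulgV_iter g; rewrite -[RHS](iter_twist1 G k).
by elim: k => //= k IHk /twist_inj.
Qed.

Lemma hmulVg g : g^-1 * g = hone.
Proof.
have [k [_ +]] := hmulgV_iter g; rewrite -[RHS](iter_twist1 G k).
by elim: k => //= k IHk /twist_inj.
Qed.

Lemma hmulI g : injective (hmul g).
Proof.
have gE x : twist (g^-1) * (g * x) = twist (twist x).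
  by rewrite hmulA hmulVg hmul1g.
by move=> h k e; apply/twist_inj/twist_inj; rewrite -!gE e.
Qed.

Lemma hinv_uniq g h : g * h = hone -> h = g^-1.
Proof. by rewrite -(hmulgV g) => /hmulI. Qed.

Lemma hinv1 : (hone : G)^-1 = hone.
Proof. by apply/esym/hinv_uniq; rewrite hmul1g twist1. Qed.

Lemma hinvK g : (g^-1)^-1 = g.
Proof. by apply/esym/hinv_uniq; rewrite hmulVg. Qed.

Lemma twistV g : twist (g^-1) = (twist g)^-1.
Proof. by apply: hinv_uniq; rewrite -twistM hmulgV twist1. Qed.

End RegularTheory.

(* The well-definedness of the operations on cosets is proved through the
   group law u g h = twist^-1 (g * h) on the same carrier. *)
Section Untwist.
Variables (G : regHomGroupType) (ai : G -> G).
Hypotheses (twistK : cancel (@twist G) ai) (aiK : cancel ai (@twist G)).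
Implicit Types g h k n : G.
Let N := @commutator G.
Let u g h := ai (g * h).

Let twist_u g h : twist (u g h) = g * h. Proof. exact: aiK. Qed.

Let aiM g h : ai (g * h) = ai g * ai h.
Proof. by apply: (can_inj twistK); rewrite aiK twistM !aiK. Qed.

Let aiV g : ai (g^-1) = (ai g)^-1.
Proof. by apply: (can_inj twistK); rewrite aiK twistV aiK. Qed.

Let ai1 : ai hone = hone.
Proof. by rewrite -[in LHS](twist1 (s := G)) twistK. Qed.

Let uA g h k : u g (u h k) = u (u g h) k.
Proof.
by do 2!apply: (can_inj twistK); rewrite !twist_u !twistM !twist_u hmulA.
Qed.

Let ug1 g : u g hone = g. Proof. by rewrite /u hmulg1 twistK. Qed.
Let u1g g : u hone g = g. Proof. by rewrite /u hmul1g twistK. Qed.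
Let ugV g : u g (g^-1) = hone. Proof. by rewrite /u hmulgV ai1. Qed.
Let uVg g : u (g^-1) g = hone. Proof. by rewrite /u hmulVg ai1. Qed.
Let uKV g h : u (g^-1) (u g h) = h. Proof. by rewrite uA uVg u1g. Qed.
Let uVK g h : u g (u (g^-1) h) = h. Proof. by rewrite uA ugV u1g. Qed.
Let uV g h : (u g h)^-1 = u (h^-1) (g^-1). Proof. by rewrite -aiV hinvM. Qed.

Let N_subgroup : hom_subgroup N.
Proof.
split.
- by move=> H [[? _ _ _] _].
- move=> g h Ng Nh H HP; have [[_ HM _ _] _] := HP.
  by apply: HM; [apply: Ng | apply: Nh].
- move=> g Ng H HP; have [[_ _ HV _] _] := HP.
  by apply: HV; apply: Ng.
- move=> g Ng H HP; have [[_ _ _ Ht] _] := HP.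
  by apply: Ht; apply: Ng.
Qed.

Let N_comm g h : N ((g^-1 * h^-1) * (g * h)).
Proof. by move=> H [_]; apply; exists g, h. Qed.

Let N_ai n : N n -> N (ai n).
Proof.
have [N1 NM NV Nt] := N_subgroup.
move=> Nn; apply: (Nn [set x | N (ai x)]); split=> [|x [g [h ->]]] /=.
  split=> /= [|g h Ng Nh|g Ng|g Ng].
  - by rewrite ai1.
  - by rewrite aiM; apply: NM.
  - by rewrite aiV; apply: NV.
  - by rewrite twistK -[g]aiK; apply: Nt.
by rewrite !aiM !aiV; apply: N_comm.
Qed.

Let N_u g h : N g -> N h -> N (u g h).
Proof.
by have [_ NM _ _] := N_subgroup; move=> Ng Nh; apply: N_ai; apply: NM.
Qed.

Let N_V g : N g -> N (g^-1).
Proof. by have [_ _ NV _] := N_subgroup; apply: NV. Qed.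

Let N_conj h n : N n -> N (u (h^-1) (u n h)).
Proof.
move=> Nn.
have -> : u (h^-1) (u n h) = u n (u (u (n^-1) (h^-1)) (u n h)).
  by rewrite -(uA (n^-1)) uVK.
by apply: N_u => //; rewrite /u -!aiM; do 2!apply: N_ai; apply: N_comm.
Qed.

Lemma cosetP_untwist g h : coset N g = coset N h <-> N (u (g^-1) h).
Proof.
have [N1 NM NV Nt] := N_subgroup.
have sub k l : N (u (k^-1) l) -> coset N l `<=` coset N k.
  move=> Nkl _ [n Nn <-]; exists (u (u (k^-1) l) n); first exact: N_u.
  by apply: (can_inj aiK); rewrite -/(u _ _) -uA uVK.
split=> [e | Ngh].
  have [n Nn e'] : coset N g (twist h).
    by rewrite e; exists hone => //; rewrite hmulg1.
  by rewrite -[h]twistK -e' -/(u g n) uKV.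
apply/seteqP; split; apply: sub => //.
by rewrite -[g]hinvK -uV; apply: N_V.
Qed.

Lemma coset_untwist_congr g g' h h' :
  coset N g = coset N g' -> coset N h = coset N h' ->
  [/\ coset N (g * h) = coset N (g' * h'),
      coset N (twist g) = coset N (twist g'),
      coset N (g^-1) = coset N (g'^-1) &
      coset N (ai g) = coset N (ai g')].
Proof.
have [N1 NM NV Nt] := N_subgroup.
move=> /cosetP_untwist Rg /cosetP_untwist Rh.
have twist_u2 k l : u (twist k) (twist l) = twist (u k l).
  by rewrite /u -twistM twistK aiK.
split; apply/cosetP_untwist.
- rewrite -!twist_u -twistV twist_u2; apply: Nt.
  have -> : u ((u g h)^-1) (u g' h') =
            u (u (h^-1) (u (u (g^-1) g') h)) (u (h^-1) h').
    by rewrite uV -!uA uVK.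
  by apply: N_u => //; apply: N_conj.
- by rewrite -twistV twist_u2; apply: Nt.
- have := N_conj (g'^-1) (N_V Rg).
  by rewrite uV !hinvK -!uA uVK.
- by rewrite /u -aiV -aiM; apply: N_ai.
Qed.

End Untwist.

Section Abelianization.
Variable G : regHomGroupType.
Implicit Types (g h : G) (X Y Z : abelianization G).

Definition ab_class g : abelianization G :=
  exist _ (coset (@commutator G) g) (ex_intro _ g erefl).

Definition ab_repr X : G := projT1 (cid (proj2_sig X)).

Lemma ab_reprK X : ab_class (ab_repr X) = X.
Proof.
apply: eq_sig_hprop => [Y p q|]; first exact: Prop_irrelevance.
by rewrite /= /ab_repr; case: cid.
Qed.

Lemma ab_classP g h :
  ab_class g = ab_class h <->
  coset (@commutator G) g = coset (@commutator G) h.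
Proof. by split=> [[]//|e]; apply: eq_exist. Qed.

Lemma ab_congr g g' h h' :
  ab_class g = ab_class g' -> ab_class h = ab_class h' ->
  [/\ ab_class (g * h) = ab_class (g' * h'),
      ab_class (twist g) = ab_class (twist g') &
      ab_class (g^-1) = ab_class (g'^-1)].
Proof.
have [ai K1 K2] := @twist_bij G; move=> /ab_classP eg /ab_classP eh.
by have [? ? ? _] := coset_untwist_congr K1 K2 eg eh; split; apply/ab_classP.
Qed.

Definition ab_mul X Y := ab_class (ab_repr X * ab_repr Y).
Definition ab_one := ab_class hone.
Definition ab_twist X := ab_class (twist (ab_repr X)).
Definition ab_inv X := ab_class ((ab_repr X)^-1).

Lemma ab_mulE g h : ab_mul (ab_class g) (ab_class h) = ab_class (g * h).
Proof. by have [] := ab_congr (ab_reprK (ab_class g)) (ab_reprK (ab_class h)). Qed.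

Lemma ab_twistE g : ab_twist (ab_class g) = ab_class (twist g).
Proof. by have [] := ab_congr (ab_reprK (ab_class g)) (ab_reprK (ab_class g)). Qed.

Lemma ab_invE g : ab_inv (ab_class g) = ab_class (g^-1).
Proof. by have [] := ab_congr (ab_reprK (ab_class g)) (ab_reprK (ab_class g)). Qed.

Let abE := (ab_mulE, ab_twistE, ab_invE).

Lemma ab_mulA X Y Z :
  ab_mul (ab_twist X) (ab_mul Y Z) = ab_mul (ab_mul X Y) (ab_twist Z).
Proof. by rewrite -(ab_reprK X) -(ab_reprK Y) -(ab_reprK Z) !abE hmulA. Qed.

Lemma ab_twistM X Y : ab_twist (ab_mul X Y) = ab_mul (ab_twist X) (ab_twist Y).
Proof. by rewrite -(ab_reprK X) -(ab_reprK Y) !abE twistM. Qed.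

Lemma ab_mulX1 X : ab_mul X ab_one = ab_twist X.
Proof. by rewrite -(ab_reprK X) !abE hmulg1. Qed.

Lemma ab_mul1X X : ab_mul ab_one X = ab_twist X.
Proof. by rewrite -(ab_reprK X) !abE hmul1g. Qed.

Lemma ab_twist1 : ab_twist ab_one = ab_one.
Proof. by rewrite !abE twist1. Qed.

Lemma ab_invM X Y : ab_inv (ab_mul X Y) = ab_mul (ab_inv Y) (ab_inv X).
Proof. by rewrite -(ab_reprK X) -(ab_reprK Y) !abE hinvM. Qed.

Lemma ab_mulXV X : exists k : nat,
  iter k ab_twist (ab_mul X (ab_inv X)) = ab_one /\
  iter k ab_twist (ab_mul (ab_inv X) X) = ab_one.
Proof. by exists 0; rewrite /= -(ab_reprK X) !abE hmulgV hmulVg. Qed.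

HB.instance Definition _ := isHomGroup.Build (abelianization G)
  ab_mulA ab_twistM ab_mulX1 ab_mul1X ab_twist1 ab_invM ab_mulXV.

Lemma ab_twist_bij : regular (abelianization G).
Proof.
have [ai K1 K2] := @twist_bij G.
exists (fun X => ab_class (ai (ab_repr X))) => X.
  rewrite -[RHS]ab_reprK -[in RHS](K1 (ab_repr X)); apply/ab_classP.
  have /ab_classP e := ab_reprK (twist X).
  by have [] := coset_untwist_congr K1 K2 e e.
by rewrite /twist/= ab_twistE K2 ab_reprK.
Qed.

HB.instance Definition _ := HomGroup_isRegular.Build (abelianization G)
  ab_twist_bij.

End Abelianization.

(* Existence of tensor products: terms over A x B, identified when all
   Hom-bilinear maps into regular Hom-groups evaluate them equally. *)
Section TensorExistence.
Variables A B : regHomGroupType.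

Inductive tensor_term : Type :=
| Tgen of A * B
| Tmul of tensor_term & tensor_term
| Tone
| Ttwist of tensor_term
| Tuntwist of tensor_term
| Tinv of tensor_term.

Lemma untwist_ex (C : regHomGroupType) (x : C) : exists y, twist y = x.
Proof. by have [g _ gK] := @twist_bij C; exists (g x). Qed.

Definition untwist (C : regHomGroupType) (x : C) : C := sval (cid (untwist_ex x)).

Lemma untwistK (C : regHomGroupType) : cancel (@untwist C) (@twist C).
Proof. by move=> x; rewrite /untwist; case: cid. Qed.

Lemma twistK (C : regHomGroupType) : cancel (@twist C) (@untwist C).
Proof. by move=> x; apply: twist_inj; rewrite untwistK. Qed.

Fixpoint tensor_eval (C : regHomGroupType) (f : A * B -> C) t : C :=
  match t with
  | Tgen p => f p
  | Tmul s t => tensor_eval f s * tensor_eval f t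
  | Tone => hone
  | Ttwist t => twist (tensor_eval f t)
  | Tuntwist t => untwist (tensor_eval f t)
  | Tinv t => (tensor_eval f t)^-1
  end.

Definition tensor_eq (s : tensor_term) : set tensor_term :=
  [set t | forall (C : regHomGroupType) (f : A * B -> C),
    hom_bilinear f -> tensor_eval f s = tensor_eval f t].

Definition tensor : Type := {X : set tensor_term | exists t, X = tensor_eq t}.

Definition tensor_class t : tensor :=
  exist _ (tensor_eq t) (ex_intro _ t erefl).
Definition tensor_repr (X : tensor) := projT1 (cid (proj2_sig X)).

Lemma tensor_reprK X : tensor_class (tensor_repr X) = X.
Proof.
apply: eq_sig_hprop => [Y p q|]; first exact: Prop_irrelevance.
by rewrite /= /tensor_repr; case: cid.
Qed.

Lemma tensor_classP s t : tensor_class s = tensor_class t <-> tensor_eq s t.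
Proof.
split=> [[->]//|e].
apply: eq_exist; apply/seteqP; split=> r rP C f fb; last by rewrite e // rP.
by rewrite -e // rP.
Qed.

Lemma tensor_eval_repr (C : regHomGroupType) (f : A * B -> C) t :
  hom_bilinear f ->
  tensor_eval f (tensor_repr (tensor_class t)) = tensor_eval f t.
Proof.
by move=> fb; have /tensor_classP := tensor_reprK (tensor_class t); apply.
Qed.

Definition tensor_mul X Y :=
  tensor_class (Tmul (tensor_repr X) (tensor_repr Y)).
Definition tensor_one := tensor_class Tone.
Definition tensor_twist X := tensor_class (Ttwist (tensor_repr X)).
Definition tensor_untwist X := tensor_class (Tuntwist (tensor_repr X)).
Definition tensor_inv X := tensor_class (Tinv (tensor_repr X)).

Lemma tensor_mulA X Y Z :
  tensor_mul (tensor_twist X) (tensor_mul Y Z) =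
  tensor_mul (tensor_mul X Y) (tensor_twist Z).
Proof.
by apply/tensor_classP => C f fb; rewrite /= !tensor_eval_repr //= hmulA.
Qed.

Lemma tensor_twistM X Y :
  tensor_twist (tensor_mul X Y) = tensor_mul (tensor_twist X) (tensor_twist Y).
Proof.
by apply/tensor_classP => C f fb; rewrite /= !tensor_eval_repr //= twistM.
Qed.

Lemma tensor_mulX1 X : tensor_mul X tensor_one = tensor_twist X.
Proof.
by apply/tensor_classP => C f fb; rewrite /= !tensor_eval_repr //= hmulg1.
Qed.

Lemma tensor_mul1X X : tensor_mul tensor_one X = tensor_twist X.
Proof.
by apply/tensor_classP => C f fb; rewrite /= !tensor_eval_repr //= hmul1g.
Qed.

Lemma tensor_twist1 : tensor_twist tensor_one = tensor_one.
Proof.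
by apply/tensor_classP => C f fb; rewrite /= !tensor_eval_repr //= twist1.
Qed.

Lemma tensor_invM X Y :
  tensor_inv (tensor_mul X Y) = tensor_mul (tensor_inv Y) (tensor_inv X).
Proof.
by apply/tensor_classP => C f fb; rewrite /= !tensor_eval_repr //= hinvM.
Qed.

Lemma tensor_mulXV X : exists k : nat,
  iter k tensor_twist (tensor_mul X (tensor_inv X)) = tensor_one /\
  iter k tensor_twist (tensor_mul (tensor_inv X) X) = tensor_one.
Proof.
by exists 0; split; apply/tensor_classP => C f fb;
  rewrite /= !tensor_eval_repr //= ?hmulgV ?hmulVg.
Qed.

HB.instance Definition _ := isHomGroup.Build tensor
  tensor_mulA tensor_twistM tensor_mulX1 tensor_mul1X tensor_twist1
  tensor_invM tensor_mulXV.

Lemma tensor_twist_bij : regular tensor.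
Proof.
exists tensor_untwist => X; rewrite -[RHS]tensor_reprK;
  apply/tensor_classP => C f fb; rewrite /= tensor_eval_repr //=.
  by rewrite twistK.
by rewrite untwistK.
Qed.

HB.instance Definition _ := HomGroup_isRegular.Build tensor tensor_twist_bij.

Lemma tensor_product_exists :
  exists (T : regHomGroupType) (theta : A * B -> T), is_tensor_product theta.
Proof.
exists tensor, (fun p => tensor_class (Tgen p)); split.
  split=> *; apply/tensor_classP => C f fb; have [f1 f2 f3] := fb;
    by rewrite /= !tensor_eval_repr.
move=> C f fb; exists (fun X => tensor_eval f (tensor_repr X)).
split; first split; first split.
- by move=> X Y; rewrite tensor_eval_repr.
- by move=> X; rewrite tensor_eval_repr.
- by apply/funext => p /=; rewrite tensor_eval_repr.
move=> ft [[ftM ftt] ftE]; apply/funext => X.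
have ft1 : ft hone = hone.
  apply: (@hmulI _ (ft hone)); apply: etrans (esym (hmulg1 _)) => //.
  by rewrite -ftM hmulg1 ftt.
suff ftC t : ft (tensor_class t) = tensor_eval f t.
  by rewrite -[in RHS](tensor_reprK X) ftC.
elim: t => /= [p|s IHs t IHt||t IHt|t IHt|t IHt].
- by rewrite -ftE.
- rewrite -IHs -IHt -ftM; congr ft.
  by apply/tensor_classP => D h hb; rewrite /= !tensor_eval_repr.
- exact: ft1.
- rewrite -IHt -ftt; congr ft.
  by apply/tensor_classP => D h hb; rewrite /= !tensor_eval_repr.
- apply: (can_inj (@twistK C)); rewrite untwistK -ftt -IHt; congr ft.
  by apply/tensor_classP => D h hb; rewrite /= !tensor_eval_repr // untwistK.
- apply: hinv_uniq; rewrite -IHt -ftM -[RHS]ft1; congr ft.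
  by apply/tensor_classP => D h hb; rewrite /= !tensor_eval_repr //= hmulgV.
Qed.

End TensorExistence.

(* Main.v *)
Require Import Defs.
From HB Require Import structures.
From mathcomp Require Import all_boot.
From mathcomp Require Import boolp classical_sets.

(** A regular Hom-group is a group with product [twist^-1 (g * h)] together
    with the automorphism [twist], and a Hom-bilinear map between regular
    Hom-groups is a map that is bilinear for these group laws and commutes with
    the twists. The theorem then follows from the classical argument.

    Expanding [f (a1 + a2, b1 + b2)] in the two possible orders gives
    [f (a1, b2) + f (a2, b1) = f (a2, b1) + f (a1, b2)]: any two values of a
    Hom-bilinear map commute ([bilinear_commute]). This has two consequences.

    First, the elements of a tensor product are generated by the values of
    [theta] ([tensor_product_ind]), so a tensor product is abelian
    ([tensor_product_abelian]).

    Second, a Hom-bilinear map kills commutators in each variable, so its value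
    depends only on the classes of its arguments in the abelianizations
    ([bilinear_ab_congr]). Hence the Hom-bilinear maps on [A * B] and those on
    [abelianization A * abelianization B] correspond to each other along the
    quotient maps, and the two universal properties provide mutually inverse
    homomorphisms. *)

Set Implicit Arguments.
Unset Strict Implicit.
Unset Printing Implicit Defensive.

Local Open Scope classical_set_scope.
Local Open Scope homgroup_scope.

(** * Commutation in regular Hom-groups *)

Section Commutation.
Variable G : regHomGroupType.
Implicit Types g x y z w : G.

Lemma hmulIr g : injective (fun x => x * g).
Proof.
have gE x : (x * g) * twist (g^-1) = twist (twist x).
  by rewrite -hmulA hmulgV hmulg1.
by move=> h k /= e; apply/twist_inj/twist_inj; rewrite -!gE e.
Qed.

(** Up to twists, this is [(x y) (z w) = x (y z) w] in the underlying group;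
    it lets the outer factors be cancelled. *)
Lemma hmul4E x y z w :
  (x * y) * (z * w) = twist x * ((untwist y * untwist z) * w).
Proof.
have -> : (untwist y * untwist z) * w = y * (untwist z * untwist w).
  by rewrite -[in LHS](untwistK w) -hmulA untwistK.
by rewrite hmulA twistM !untwistK.
Qed.

Lemma hmul4_commute x y z w :
  (x * y) * (z * w) = (x * z) * (y * w) -> y * z = z * y.
Proof.
rewrite !hmul4E => /hmulI /hmulIr /(congr1 twist).
by rewrite !twistM !untwistK.
Qed.

(** The product law [(x x') (twist y') = twist x (x' y')] moves an element
    through a product only at the price of a twist, which is why [S] has to be
    stable under [twist] and its inverse. *)
Lemma centralizer_closed (S : set G)
    (St : forall y, S y -> S (twist y)) (Su : forall y, S y -> S (untwist y)) :
  let C := [set x : G | forall y, S y -> x * y = y * x] in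
  [/\ hom_subgroup C & forall x, C x -> C (untwist x)].
Proof.
split; [split|] => /=.
- by move=> y _; rewrite hmul1g hmulg1.
- move=> x x' Cx Cx' y Sy; have Sy' := Su _ Sy.
  by rewrite -[y]untwistK -hmulA Cx' // hmulA Cx // hmulA.
- move=> x Cx y Sy; apply: (@hmulI _ (twist x)).
  by rewrite !hmulA hmulgV Cx // -hmulA hmulgV hmul1g hmulg1.
- move=> x Cx y Sy.
  by rewrite -[y]untwistK -!twistM Cx //; apply: Su.
- move=> x Cx y Sy; apply: twist_inj.
  by rewrite !twistM untwistK Cx //; apply: St.
Qed.

End Commutation.

(** * Hom-bilinear maps *)

Section Bilinear.
Variables (A B C : regHomGroupType) (f : A * B -> C).
Hypothesis fb : hom_bilinear f.

(** Compare the two expansions of the value of [f] at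
    [(twist (a1 * a2), twist (b1 * b2))]. *)
Lemma bilinear_commute p q : f p * f q = f q * f p.
Proof.
have [fl fr ft] := fb; case: p q => [a1 b2] [a2 b1].
apply: (@hmul4_commute _ (f (a1, b1)) _ _ (f (a2, b2))).
by rewrite -!fr -!fl -!fr !twistM.
Qed.

Lemma bilinear1l b : f (hone, b) = hone.
Proof.
have [fl _ ft] := fb; rewrite -[b]untwistK.
apply: (@hmulI _ (f (hone, twist (untwist b)))).
by rewrite -fl hmulg1 hmulg1 ft.
Qed.

Lemma bilinearVl a b : f (a^-1, b) = (f (a, b))^-1.
Proof.
by have [fl _ _] := fb; apply: hinv_uniq; rewrite -fl hmulgV bilinear1l.
Qed.

(** The left kernel is a Hom-subgroup, and it contains the commutators because
    the values of [f] commute. *)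
Lemma bilinear_commutator a b : commutator a -> f (a, b) = hone.
Proof.
have [fl _ ft] := fb; move=> Na; move: b.
apply: (Na [set x | forall b, f (x, b) = hone]); split=> [|x [g [h ->]]] /=.
  split=> /=.
  - exact: bilinear1l.
  - by move=> g h Kg Kh b; rewrite -[b]untwistK fl Kg Kh hmulg1 twist1.
  - by move=> g Kg b; rewrite bilinearVl Kg hinv1.
  - by move=> g Kg b; rewrite -[b]untwistK ft Kg twist1.
move=> b; rewrite -[b]untwistK fl -[untwist b]untwistK !fl !bilinearVl.
by rewrite (bilinear_commute (g, _)) -hinvM hmulVg.
Qed.

Lemma bilinear_ab_congrl a a' b :
  ab_class a = ab_class a' -> f (a, b) = f (a', b).
Proof.
have [fl _ ft] := fb.
move=> /ab_classP /(cosetP_untwist (@twistK A) (@untwistK A)).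
move=> /bilinear_commutator - /(_ b) /(congr1 twist).
rewrite -ft untwistK fl bilinearVl twist1 => /hinv_uniq.
by rewrite hinvK => ->.
Qed.

Lemma bilinear_swap : hom_bilinear (fun p : B * A => f (p.2, p.1)).
Proof. by have [fl fr ft] := fb; split=> *; rewrite /= ?fl ?fr ?ft. Qed.

End Bilinear.

Lemma bilinear_ab_congr (A B C : regHomGroupType) (f : A * B -> C) a a' b b' :
  hom_bilinear f -> ab_class a = ab_class a' -> ab_class b = ab_class b' ->
  f (a, b) = f (a', b').
Proof.
move=> fb ea eb; rewrite (bilinear_ab_congrl fb b ea).
exact: (bilinear_ab_congrl (bilinear_swap fb) a' eb).
Qed.

Lemma bilinear_lift (A B C : regHomGroupType)
    (f : abelianization A * abelianization B -> C) :
  hom_bilinear f ->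
  hom_bilinear (fun p : A * B => f (ab_class p.1, ab_class p.2)).
Proof.
by move=> [fl fr ft]; split=> *; rewrite /= -?ab_mulE -?ab_twistE ?fl ?fr ?ft.
Qed.

Lemma bilinear_descend (A B C : regHomGroupType) (f : A * B -> C) :
  hom_bilinear f ->
  hom_bilinear (fun p : abelianization A * abelianization B =>
    f (ab_repr p.1, ab_repr p.2)).
Proof.
move=> fb; have [fl fr ft] := fb.
by split=> *; rewrite /= -?fl -?fr -?ft; apply: bilinear_ab_congr => //;
  apply: ab_reprK.
Qed.

(** * Tensor products *)

Section TensorProduct.
Variables (A B T : regHomGroupType) (theta : A * B -> T).
Hypothesis thetaT : is_tensor_product theta.

Lemma tensor_product_endo (h : T -> T) :
  is_hom h -> (forall p, h (theta p) = theta p) -> h =1 id.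
Proof.
move=> hh hE; have [bT /(_ _ _ bT)[k [_ uk]]] := thetaT.
have <- : k = h by apply: uk; split=> //; apply/funext => p /=.
by have -> : k = id by apply: uk.
Qed.

(** The term model [tensor A B] supplies the elements generated by [theta]: the
    composite [T -> tensor A B -> T], where the second map evaluates terms at
    [theta], is the identity by uniqueness, so every element of [T] is the value
    of a term. *)
Lemma tensor_product_ind (P : set T) :
  (forall p, P (theta p)) -> hom_subgroup P ->
  (forall x, P x -> P (untwist x)) -> forall x, P x.
Proof.
move=> Ptheta [P1 PM PV Pt] Pu x; have [bT univ] := thetaT.
have bgen : hom_bilinear (fun p : A * B => tensor_class (Tgen p)).
  by split=> *; apply/tensor_classP => C f fb; have [f1 f2 f3] := fb;
    rewrite /= !tensor_eval_repr.
have [k [[[kM kt] kE] _]] := univ (tensor A B) _ bgen.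
pose h y := tensor_eval theta (tensor_repr (k y)).
have hh : is_hom h.
  by split=> *; rewrite /h ?kM ?kt tensor_eval_repr.
have hE p : h (theta p) = theta p.
  by rewrite /h -[k _]/((k \o theta) p) kE tensor_eval_repr.
rewrite -[x](tensor_product_endo hh hE) /h.
by elim: (tensor_repr _) => //= *; auto.
Qed.

(** Generators commute with each other; hence all elements commute with the
    generators, and then with everything. *)
Lemma tensor_product_abelian : abelian T.
Proof.
have [bT _] := thetaT; have [_ _ thetat] := bT.
have thetaC x p : x * theta p = theta p * x.
  have [|y [q _ <-]|sC uC] := @centralizer_closed _ (range theta).
  - by move=> y [[a b] _ <-]; exists (twist a, twist b).
  - case: q => a b; exists (untwist a, untwist b) => //.
    by apply: twist_inj; rewrite -thetat !untwistK.
  apply: (@tensor_product_ind _ _ sC uC); last by exists p.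
  by move=> q y [r _ <-]; apply: bilinear_commute.
move=> x y.
have [//|//|sC uC] := @centralizer_closed T setT.
apply: (@tensor_product_ind _ _ sC uC) => // p z _.
by rewrite thetaC.
Qed.

End TensorProduct.

Theorem proposition5p10 (A B : regHomGroupType)
    (AB : regHomGroupType) (theta : A * B -> AB)
    (hAB : is_tensor_product theta)
    (ABab : regHomGroupType)
    (theta_ab : abelianization A * abelianization B -> ABab)
    (hABab : is_tensor_product theta_ab) :
  isomorphic AB ABab /\ (regular AB /\ abelian AB).
Proof.
split; last by split; [exact: twist_bij | exact: tensor_product_abelian hAB].
have [bT univ] := hAB; have [bTab univ_ab] := hABab.
have [F [[[FM Ft] FE] _]] := univ _ _ (bilinear_lift bTab).
have [H [[[HM Ht] HE] _]] := univ_ab _ _ (bilinear_descend bT).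
exists F; split=> //; exists H.
  apply: (tensor_product_endo hAB (h := H \o F)) => [|[a b]] /=.
    by split=> *; rewrite /= ?FM ?Ft ?HM ?Ht.
  rewrite -[F _]/((F \o theta) _) FE -[H _]/((H \o theta_ab) _) HE /=.
  by apply: bilinear_ab_congr => //; apply: ab_reprK.
apply: (tensor_product_endo hABab (h := F \o H)) => [|[X Y]] /=.
  by split=> *; rewrite /= ?HM ?Ht ?FM ?Ft.
by rewrite -[H _]/((H \o theta_ab) _) HE -[F _]/((F \o theta) _) FE /= !ab_reprK.
Qed.
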